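(* Let $\Omega$ be a non-sparse $ER[N,p]$ network ensemble with $p>0$ independent of $N$, and let $H(G)=\min_{\vec s\in S}h_G(\vec s)$ be the optimal graph partitioning value, where $$h_G(\vec s)=-\frac1N\sum_{i,j}A_{ij}s_is_j.$$ Assume that $\langle H\rangle_\Omega$ is of the order $O(N)$. Then for every real $t>0$, $$P\left(|H(G)-\langle H\rangle_\Omega|>Nt\right)\le 2\exp\left(-N^2t^2\right).$$
   Context: $ER[N,p]$ is the Erdős–Rényi random graph on $N$ labelled nodes in which any two nodes are linked by an edge, independently, with probability $p$. $[A_{ij}]$ is the adjacency matrix of the random network $G$, $P$ is the law of the ensemble and $\langle\cdot\rangle_\Omega$ the corresponding expectation. The sum $\sum_{i,j}$ runs over all $i,j=1,\dots,N$. Spin vectors are $\vec s=(s_1,\dots,s_N)$, $s_i\in\{-1,1\}$, and $S\subseteq\{-1,1\}^N$ is the (nonempty) spin configuration space: either all of $\{-1,1\}^N$, or the configurations with zero magnetization $\sum_is_i=0$, or with a fixed magnetization $\sum_is_i=c\neq0$. *)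

(* Defs.v *)
From HB Require Import structures.
From mathcomp Require Import all_boot all_order all_algebra.
From mathcomp Require Import all_classical all_reals all_analysis.

Set Implicit Arguments.
Unset Strict Implicit.
Unset Printing Implicit Defensive.

Import Order.TTheory GRing.Theory Num.Theory.
Import numFieldNormedType.Exports.

Local Open Scope ring_scope.

(* Unordered pairs of distinct nodes, each represented once by (i, j), i < j. *)
Definition edge (N : nat) := {e : 'I_N * 'I_N | (e.1 < e.2)%N}.

(* Simple labelled graphs on N nodes, as edge sets. *)
Definition graph (N : nat) := {set edge N}.

Definition adj (N : nat) (G : graph N) (i j : 'I_N) : bool :=
  [exists e in G, (val e == (i, j)) || (val e == (j, i))].

Definition er_law (R : realType) (p : R) (N : nat) (G : graph N) : R :=
  \prod_(e : edge N) (if e \in G then p else 1 - p).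

Definition er_prob (R : realType) (p : R) (N : nat) (E : pred (graph N)) : R :=
  \sum_(G : graph N | E G) er_law p G.

Definition er_mean (R : realType) (p : R) (N : nat) (X : graph N -> R) : R :=
  \sum_(G : graph N) er_law p G * X G.

(* A spin vector is stored through sign bits: s_i = (-1) ^ (s i). *)
Definition config (N : nat) := {ffun 'I_N -> bool}.

Definition spin (R : pzRingType) (N : nat) (s : config N) (i : 'I_N) : R :=
  (-1) ^+ s i.

Inductive spin_space := AllSpins | FixedMagnetization of int.

Definition configs (N : nat) (S : spin_space) : {set config N} :=
  match S with
  | AllSpins => [set: config N]
  | FixedMagnetization c => [set s : config N | \sum_(i < N) spin int s i == c]
  end.

Definition energy (R : realType) (N : nat) (G : graph N) (s : config N) : R :=
  - (N%:R^-1 * \sum_(i < N) \sum_(j < N) (adj G i j)%:R * spin R s i * spin R s j).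

(* The minimum of the energy over the configuration space; the value 0 is a
   convention for an empty space (e.g. zero magnetization with N odd). *)
Definition opt_value (R : realType) (S : spin_space) (N : nat) (G : graph N) : R :=
  if [pick s in configs N S] is Some s0
  then energy R G [arg min_(s < s0 in configs N S) energy R G s]%O
  else 0.

(* Edges are independent and each is present with probability p: the events
   "all of F present and all of K absent" factorize. *)
Lemma er_prob_edges (R : realType) (p : R) (N : nat) (F K : {set edge N}) :
  [disjoint F & K] ->
  er_prob p [pred G : graph N | (F \subset G) && [disjoint K & G]]
  = p ^+ #|F| * (1 - p) ^+ #|K|.
Proof.
move=> dFK; pose f e := if e \in K then 0 else p.
pose g e := if e \in F then 0 else 1 - p.
have -> : p ^+ #|F| * (1 - p) ^+ #|K| = \prod_(e : edge N) (f e + g e).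
  rewrite -!prodr_const !(big_mkcond (fun e => e \in _)) -big_split /=.
  apply: eq_bigr => e _; rewrite /f /g; case: ifP => eF.
    by rewrite (disjointFr dFK eF) addr0 mulr1.
  by case: ifP => _; rewrite ?mulr1 ?mul1r ?add0r // addrC subrK.
rewrite bigA_distr /er_prob big_mkcond /=; apply: eq_bigr => G _.
case: ifP => [/andP[/fintype.subsetP FG dKG]|FKG].
  apply: eq_bigr => e _; rewrite /f /g; case: ifP => eG.
    by rewrite (disjointFl dKG eG).
  by case: ifP => // /FG; rewrite eG.
suff [e e0] : exists e, (if e \in G then f e else g e) = 0.
  by rewrite (bigD1 e) //= e0 mul0r.
move: FKG => /negbT; rewrite negb_and => /orP[/fintype.subsetPn[e eF eG]|].
  by exists e; rewrite (negbTE eG) /g eF.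
rewrite disjoint_subset => /fintype.subsetPn[e eK]; rewrite inE negbK => eG.
by exists e; rewrite eG /f eK.
Qed.

Lemma adj_sym (N : nat) (G : graph N) (i j : 'I_N) : adj G i j = adj G j i.
Proof. by apply/eq_existsb => e; rewrite orbC. Qed.

Lemma adj_irrefl (N : nat) (G : graph N) (i : 'I_N) : adj G i i = false.
Proof.
by apply/existsP => -[[[a b] /= lt_ab]] /andP[_ /orP[]] /eqP /= [ea eb];
  move: lt_ab; rewrite ea eb ltnn.
Qed.

Lemma adj_edge (N : nat) (G : graph N) (e : edge N) :
  adj G (val e).1 (val e).2 = (e \in G).
Proof.
apply/existsP/idP => [[f /andP[fG /orP[]/eqP fe]]|eG].
- suff -> : e = f by [].
  by apply: val_inj; rewrite fe -surjective_pairing.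
- have := valP f; have := valP e; rewrite fe /= => lt1 lt2.
  by have := ltn_trans lt1 lt2; rewrite ltnn.
- by exists e; rewrite eG -surjective_pairing eqxx.
Qed.

Lemma opt_valueP (R : realType) (S : spin_space) (N : nat) (G : graph N) :
  configs N S != finset.set0 ->
  (exists2 s, s \in configs N S & opt_value R S G = energy R G s) /\
  (forall s, s \in configs N S -> opt_value R S G <= energy R G s).
Proof.
case/finset.set0Pn => s1 s1S; rewrite /opt_value; case: pickP => [s0 s0S|/(_ s1)]; last first.
  by rewrite s1S.
by case: arg_minP => // s sS smin; split; [exists s | ].
Qed.

(* Main.v *)
(* McDiarmid's bounded differences argument. Flipping one edge changes the energy
   of every configuration, hence its minimum, by at most c = 2 / N. Averaging out
   the edges one at a time, each averaging costs a factor exp ((l c)^2 / 8) in the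
   moment generating function by Hoeffding's lemma for a two-point law. There are
   m <= N^2 / 2 edges, so Chernoff's bound with l = 2 N t gives the exponent
   m (l c)^2 / 8 - l N t = 2 m t^2 - 2 N^2 t^2 <= - N^2 t^2. *)
Require Import Defs.
From HB Require Import structures.
From mathcomp Require Import all_boot all_order all_algebra.
From mathcomp Require Import all_classical all_reals all_analysis.
From mathcomp Require Import ring lra.

Set Implicit Arguments.
Unset Strict Implicit.
Unset Printing Implicit Defensive.

Import Order.TTheory GRing.Theory Num.Theory.
Import numFieldNormedType.Exports.

Local Open Scope classical_set_scope.
Local Open Scope ring_scope.

(** * Hoeffding's lemma for two-point laws *)

Lemma derive_ge0_le (R : realType) (f f' : R -> R) :
  (forall x : R, is_derive x (1 : R) f (f' x)) ->
  (forall x, 0 <= x -> 0 <= f' x) -> forall x, 0 <= x -> f 0 <= f x.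
Proof.
move=> df f'_ge0 x x_ge0; apply: (@ger0_derive1_ndecry _ f 0) => //.
- move=> y; rewrite in_itv/= andbT => y_gt0; have dfy := df y.
  by rewrite derive1E derive_val f'_ge0 // ltW.
- apply: continuous_subspaceT => y; have dfy := df y.
  by apply/differentiable_continuous/derivable1_diffP.
Qed.

(* The logarithm of the ratio of the two sides vanishes to first order at 0; its
   second derivative is 1/4 - q (1 - q) >= 0, q = p e^x / (p e^x + 1 - p). *)
Lemma bernoulli_mgf_ge0 (R : realType) (p x : R) : 0 <= p <= 1 -> 0 <= x ->
  p * expR x + (1 - p) <= expR (p * x + x ^+ 2 / 8).
Proof.
move=> /andP[p_ge0 p_le1] x_ge0.
pose D (y : R) : R := p * expR y + (1 - p).
have D_gt0 y : 0 < D y.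
  rewrite /D; have := expR_gt0 y; have [->|p_neq0] := eqVneq p 0.
    by rewrite mul0r add0r subr0 ltr01.
  have p_gt0 : 0 < p by rewrite lt_def p_neq0.
  by move=> ey; rewrite ltr_pwDl ?mulr_gt0 // subr_ge0.
have dD y : is_derive y (1 : R) D (p * expR y).
  have -> : D = p \*: (expR : R -> R) + cst (1 - p) by [].
  by apply: is_derive_eq; rewrite addr0.
(* [h] is the derivative of [g] below, rewritten through [p * expR y / D y = 1 - (1 - p) / D y] so
   that [y] occurs in a single quotient. *)
pose h (y : R) : R := y / 4 + p - 1 + (1 - p) / D y.
have dh y : is_derive y (1 : R) h (4^-1 - (1 - p) * (p * expR y) / D y ^+ 2).
  have -> : h = 4^-1 \*: id + cst (p - 1) + (1 - p) \*: (fun y => (D y)^-1).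
    by apply/funext => z; rewrite /h !fctE /= /GRing.scale/= [z / 4]mulrC addrA. 
  apply: is_derive_eq (is_deriveD (is_deriveD (is_deriveZ _ (is_derive_id _ _))
    (is_derive_cst _ _ _))
    (is_deriveZ _ (is_deriveV (lt0r_neq0 (D_gt0 y)) (dD y)))) _.
  rewrite /GRing.scale/=.
  by have := lt0r_neq0 (D_gt0 y) => ?; field.
have h_ge0 y : 0 <= y -> 0 <= h y.
  move=> y_ge0; have <- : h 0 = 0.
    by rewrite /h /D expR0 mul0r; rewrite mulr1 [p + _]addrC subrK divr1; ring.
  apply: (derive_ge0_le dh) => // z _.
  (* The arithmetic-geometric mean inequality: [D z ^+ 2 - 4 * (1 - p) * (p * expR z)] is the square
     of [p * expR z - (1 - p)]. *)
  rewrite subr_ge0 ler_pdivrMr ?exprn_gt0 //.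
  have := sqr_ge0 (p * expR z - (1 - p)); rewrite /D; nra.
pose g (y : R) : R := p * y + y ^+ 2 / 8 - ln (D y).
have dg y : is_derive y (1 : R) g (h y).
  have -> : g = p \*: id + 8^-1 \*: (id * id) - (@ln R \o D).
    by apply/funext => z; rewrite /g !fctE /= /GRing.scale/= [_ / 8]mulrC.
  apply: is_derive_eq (is_deriveB (is_deriveD (is_deriveZ _ (is_derive_id _ _))
    (is_deriveZ _ (is_deriveM (is_derive_id _ _) (is_derive_id _ _))))
    (is_derive1_comp (is_derive1_ln (D_gt0 y)) (dD y))) _.
  rewrite /GRing.scale/= /h.
  by have := lt0r_neq0 (D_gt0 y); rewrite /D => ?; field.
have : g 0 <= g x by exact: (derive_ge0_le dg).
rewrite /g /D expR0 mulr0 expr0n /= mul0r addr0.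
rewrite mulr1 [p + _]addrC subrK.
rewrite ln1 subr0 subr_ge0 => /(fun H => le_trans (eqbRL (ler_expR _ _) H)).
by rewrite lnK ?posrE; [apply|exact: D_gt0].
Qed.

(** For [x < 0], exchange the two outcomes: the bound for [1 - p] at [- x], multiplied by [expR x],
    is the bound for [p] at [x]. *)
Lemma bernoulli_mgf (R : realType) (p x : R) : 0 <= p <= 1 ->
  p * expR x + (1 - p) <= expR (p * x + x ^+ 2 / 8).
Proof.
move=> p01; have [|x_lt0] := leP 0 x; first exact: bernoulli_mgf_ge0.
have q01 : 0 <= 1 - p <= 1 by lra.
have := bernoulli_mgf_ge0 q01 (ltW (eqbRL (oppr_gt0 x) x_lt0)).
rewrite -(ler_pM2l (expR_gt0 x)) -expRD mulrDr mulrCA -expRD subrr expR0.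
by move=> le_x; apply: le_trans (le_trans le_x _); [lra|rewrite ler_expR; lra].
Qed.

(** Factoring out [expR (l * b)] leaves a Bernoulli variable scaled by [x = l * (a - b)], and
    [x ^+ 2 <= (l * c) ^+ 2]. *)
Lemma hoeffding_two_point (R : realType) (p a b c l : R) : 0 <= p <= 1 ->
  `|a - b| <= c ->
  p * expR (l * a) + (1 - p) * expR (l * b) <=
    expR (l * (p * a + (1 - p) * b) + (l * c) ^+ 2 / 8).
Proof.
move=> p01 ab_le; pose x := l * (a - b).
have -> : l * a = l * b + x by rewrite /x; ring.
rewrite expRD mulrCA [(1 - p) * _]mulrC -mulrDr.
apply: le_trans (ler_wpM2l (expR_ge0 _) (bernoulli_mgf x p01)) _.
rewrite -expRD ler_expR addrA.
have -> : l * b + p * x = l * (p * a + (1 - p) * b) by rewrite /x; ring.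
rewrite lerD2l ler_pM2r ?invr_gt0 // /x !exprMn ler_wpM2l ?sqr_ge0 //.
by rewrite -real_normK ?num_real // lerXn2r ?nnegrE // (le_trans _ ab_le).
Qed.

(** * Averaging out the edges one at a time *)

(* Conditional expectation of f given all edges but e. *)
Definition resample (R : realType) (p : R) (N : nat) (f : graph N -> R)
    (e : edge N) (G : graph N) : R :=
  p * f (e |: G) + (1 - p) * f (G :\ e).

Arguments resample {R} p {N} f e G.

(** The case [c = 0] expresses that [f] does not depend on the state of [e]. *)
Definition edge_lip (R : realType) (c : R) (N : nat) (f : graph N -> R)
    (e : edge N) :=
  forall G, `|f (e |: G) - f (G :\ e)| <= c.

Lemma ler_resample (R : realType) (p : R) (N : nat) (e : edge N) f g :
  0 <= p <= 1 -> (forall G, f G <= g G) ->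
  forall G, resample p f e G <= resample p g e G.
Proof.
by move=> /andP[p0 p1] fg G; rewrite lerD // ler_wpM2l // subr_ge0.
Qed.

Lemma ler_resamples (R : realType) (p : R) (N : nat) (s : seq (edge N)) f g :
  0 <= p <= 1 -> (forall G, f G <= g G) ->
  forall G, foldl (resample p) f s G <= foldl (resample p) g s G.
Proof.
by move=> p01; elim: s f g => //= e s IH f g fg; apply: IH; exact: ler_resample.
Qed.

Lemma resamplesZ (R : realType) (p k : R) (N : nat) (s : seq (edge N)) f G :
  foldl (resample p) (fun G => k * f G) s G = k * foldl (resample p) f s G.
Proof.
elim: s f => //= e s IH f; rewrite -IH; congr (foldl _ _ s G).
by apply/funext => H; rewrite /resample; ring.
Qed.

Lemma setU1_setD1_comm (T : finType) (x y : T) (A : {set T}) : x != y ->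
  (x |: A) :\ y = x |: (A :\ y).
Proof.
move=> xy; apply/setP => z; rewrite !inE.
by case: (eqVneq z x) => [->|]; rewrite ?xy.
Qed.

Lemma resample_id (R : realType) (p : R) (N : nat) (e : edge N) f G :
  resample p f e (e |: G) = resample p f e (G :\ e).
Proof.
rewrite /resample; congr (_ * f _ + _ * f _); apply/setP => x; rewrite !inE;
by case: (x == e).
Qed.

(** For [e' != e] the difference is a convex combination of two differences of [f] across [e']; for
    [e' = e] it vanishes. *)
Lemma edge_lip_resample (R : realType) (p c : R) (N : nat) (e e' : edge N) f :
  0 <= p <= 1 -> edge_lip c f e' -> edge_lip c (resample p f e) e'.
Proof.
move=> /andP[p0 p1] fc G; have [->|ee'] := eqVneq e' e.
  by rewrite resample_id subrr normr0 (le_trans (normr_ge0 _) (fc G)).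
rewrite /resample finset.setUCA setU1_setD1_comm //.
rewrite -(@setU1_setD1_comm _ e) 1?eq_sym //.
have -> : G :\ e' :\ e = G :\ e :\ e' by rewrite !finset.setDDl finset.setUC.
have q0 : 0 <= 1 - p by rewrite subr_ge0.
rewrite opprD addrACA -!mulrBr (le_trans (ler_normD _ _)) //.
rewrite !normrM (ger0_norm p0) (ger0_norm q0).
apply: le_trans (lerD (ler_wpM2l p0 (fc _)) (ler_wpM2l q0 (fc _))) _.
by rewrite -mulrDl [p + _]addrC subrK mul1r.
Qed.

(** Induction on [s]: Hoeffding's lemma at the head edge costs a constant factor [expR K], which
    passes through the remaining resamplings by linearity, and the resampled function satisfies the
    same Lipschitz bounds. *)
Lemma mgf_resamples (R : realType) (p c l : R) (N : nat) (s : seq (edge N)) f G :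
  0 <= p <= 1 -> (forall e, edge_lip c f e) ->
  foldl (resample p) (fun G => expR (l * f G)) s G <=
    expR (l * foldl (resample p) f s G + (size s)%:R * ((l * c) ^+ 2 / 8)).
Proof.
move=> p01; elim: s f => [|e s IH] f fc /=; first by rewrite mul0r addr0.
set K := (l * c) ^+ 2 / 8.
apply: (@le_trans _ _ (foldl (resample p)
    (fun G => expR K * expR (l * resample p f e G)) s G)).
  apply: ler_resamples => // H.
  rewrite -expRD [K + _]addrC; apply: hoeffding_two_point => //; exact: fc.
rewrite resamplesZ.
have fce e' : edge_lip c (resample p f e) e' by exact: edge_lip_resample.
apply: le_trans (ler_wpM2l (expR_ge0 _) (IH _ fce)) _.
by rewrite -expRD ler_expR -/K -natr1; lra.
Qed.

(** * Resampling and the mean of the random graph law *)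

Lemma er_law_ge0 (R : realType) (p : R) (N : nat) (G : graph N) :
  0 <= p <= 1 -> 0 <= er_law p G.
Proof.
by move=> /andP[p0 p1]; apply: prodr_ge0 => e _; case: ifP => // _; rewrite subr_ge0.
Qed.

Lemma er_mean_cst (R : realType) (p k : R) (N : nat) :
  er_mean p (fun _ : graph N => k) = k.
Proof.
(* The total mass is 1: this is the probability of the event with no prescribed edges. *)
rewrite /er_mean -mulr_suml; have := @er_prob_edges R p N finset.set0 finset.set0.
rewrite finset.disjoints_subset finset.sub0set !cards0 !expr0 mulr1 /er_prob => /(_ isT).
rewrite (eq_bigl xpredT) => [->|G]; first by rewrite mul1r.
by rewrite /= finset.sub0set finset.disjoints_subset finset.sub0set.
Qed.

Lemma er_mean_resample (R : realType) (p : R) (N : nat) (e : edge N) f :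
  er_mean p (resample p f e) = er_mean p f.
Proof.
pose w (G : graph N) := \prod_(e' : edge N | e' != e) (if e' \in G then p else 1 - p).
have law G : er_law p G = (if e \in G then p else 1 - p) * w G.
  by rewrite /er_law (bigD1 e).
have wU G : w (e |: G) = w G.
  by apply: eq_bigr => e' /negbTE e'e; rewrite !inE e'e.
(* Pair each graph avoiding [e] with the graph obtained by adding [e]; by independence both carry
   the common weight [w G]. *)
have split_mean g : er_mean p g =
    \sum_(G : graph N | e \notin G) w G * (p * g (e |: G) + (1 - p) * g G).
  rewrite /er_mean (bigID (fun G : graph N => e \in G)) /=.
  rewrite (reindex_onto (fun G => e |: G) (fun G => G :\ e)) /=; last first.
    by move=> G; exact: finset.setD1K.
  rewrite [X in X + _](eq_bigl (fun G : graph N => e \notin G)) => [|G]; last first.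
    rewrite finset.setU11 /=; apply/eqP/idP => [<-|eG]; last exact: finset.setU1K.
    by rewrite !inE eqxx.
  rewrite -big_split /=; apply: eq_bigr => G eG.
  by rewrite !law finset.setU11 (negbTE eG) wU; ring.
rewrite !split_mean; apply: eq_bigr => G eG; congr (_ * _).
have GD : G :\ e = G by apply/finset.setDidPl; rewrite disjoint_sym disjoints1.
by rewrite resample_id GD -mulrDl [p + _]addrC subrK mul1r /resample GD.
Qed.

(* After every edge has been resampled the function is constant, and
   resampling preserves the mean. *)
Lemma resamples_enum (R : realType) (p : R) (N : nat) f (G : graph N) :
  0 <= p <= 1 -> foldl (resample p) f (enum {: edge N}) G = er_mean p f.
Proof.
move=> p01; set g := foldl _ _ _.
(* Resampling [e] removes the dependence on [e], and later resamplings do not restore it. *)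
have g_lip e : edge_lip 0 g e.
  have : e \in enum {: edge N} by rewrite mem_enum.
  have lip_resamples s h : edge_lip 0 h e -> edge_lip 0 (foldl (resample p) h s) e.
    elim: s h => //= e' s IH h he; apply: IH; exact: edge_lip_resample.
  rewrite /g; elim: (enum _) f {g} => //= e' s IH f; rewrite inE.
  case/orP => [/eqP <-|]; last exact: IH.
  by apply: lip_resamples => H; rewrite resample_id subrr normr0.
(* Delete the edges of [H] one by one; none of the deletions changes [g]. *)
have g_cst H : g H = g finset.set0.
  have [n] := ubnP #|H|; elim: n H => // n IH H; rewrite ltnS => Hn.
  have [->//|[e eH]] := finset.set_0Vmem H.
  have := g_lip e H; rewrite normr_le0 subr_eq0 => /eqP; rewrite -{1}(finset.setD1K eH).
  rewrite finset.setUA finset.setUid finset.setD1K // => ->; apply: IH.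
  by rewrite (leq_trans _ Hn) // [X in (_ < X)%N](cardsD1 e) eH.
have <- : er_mean p g = er_mean p f.
  rewrite /g; elim: (enum _) f {g g_lip g_cst} => //= e s IH f.
  by rewrite IH er_mean_resample.
rewrite -[LHS](er_mean_cst p _ N); congr (er_mean p).
by apply/funext => H; rewrite g_cst [RHS]g_cst.
Qed.

(** * Chernoff's bound *)

Lemma er_prob_gt (R : realType) (p c l u : R) (N : nat) (f : graph N -> R) :
  0 <= p <= 1 -> (forall e, edge_lip c f e) -> 0 <= l ->
  er_prob p [pred G : graph N | f G - er_mean p f > u] <=
    expR (#|{: edge N}|%:R * ((l * c) ^+ 2 / 8) - l * u).
Proof.
move=> p01 fc l0; set m := er_mean p f.
have mgf : er_mean p (fun G => expR (l * f G)) <=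
    expR (l * m + #|{: edge N}|%:R * ((l * c) ^+ 2 / 8)).
  have := mgf_resamples l (enum {: edge N}) finset.set0 p01 fc.
  by rewrite !resamples_enum // -cardE.
(* Markov's inequality: the indicator of the event is at most [expR (l * (f G - m - u))]. *)
apply: (@le_trans _ _ (expR (- (l * (m + u))) * er_mean p (fun G => expR (l * f G)))).
  rewrite /er_prob /er_mean mulr_sumr big_mkcond; apply: ler_sum => G _ /=.
  have w0 := er_law_ge0 G p01.
  rewrite mulrCA -expRD; case: ifP => [fu|_]; last by rewrite mulr_ge0 ?expR_ge0.
  rewrite ler_peMr // -expR0 ler_expR addrC subr_ge0 ler_wpM2l //.
  by rewrite addrC -lerBrDr ltW.
apply: le_trans (ler_wpM2l (expR_ge0 _) mgf) _.
by rewrite -expRD ler_expR; lra.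
Qed.

(** Union bound over the upper tails of [f] and [- f]. *)
Lemma er_prob_abs_gt (R : realType) (p c l u : R) (N : nat) (f : graph N -> R) :
  0 <= p <= 1 -> (forall e, edge_lip c f e) -> 0 <= l ->
  er_prob p [pred G : graph N | `|f G - er_mean p f| > u] <=
    2 * expR (#|{: edge N}|%:R * ((l * c) ^+ 2 / 8) - l * u).
Proof.
move=> p01 fc l0.
have nfc e : edge_lip c (fun G => - f G) e
  by move=> G; rewrite -opprD normrN; exact: fc.
have meanN : er_mean p (fun G => - f G) = - er_mean p f.
  by rewrite /er_mean -sumrN; apply: eq_bigr => G _; rewrite mulrN.
rewrite mulr2n mulrDl !mul1r.
apply: le_trans (lerD (er_prob_gt u p01 fc l0) (er_prob_gt u p01 nfc l0)).
rewrite meanN /er_prob [leLHS]big_mkcond [X in X + _]big_mkcond [X in _ + X]big_mkcond.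
rewrite -big_split; apply: ler_sum => G _ /=.
have w0 := er_law_ge0 G p01.
by rewrite -opprD ltr_normr; do 2!case: (_ < _) => /=; lra.
Qed.

(** * Number of edges and Lipschitz constants *)

Lemma card_edge (N : nat) : (#|{: edge N}|.*2 <= N ^ 2)%N.
Proof.
rewrite card_sig -addnn.
pose up : {set 'I_N * 'I_N} := finset (fun x : 'I_N * 'I_N => (x.1 < x.2)%N).
pose sw (x : 'I_N * 'I_N) := (x.2, x.1).
have swK : involutive sw by case.
have -> : #|[pred x : 'I_N * 'I_N | (x.1 < x.2)%N]| = #|up|.
  by apply: eq_card => x; rewrite !inE.
(* The increasing pairs and their swaps are disjoint sets of equal size inside the [N ^ 2] pairs. *)
rewrite -{2}(card_imset up (inv_inj swK)) -cardsUI.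
have -> : up :&: sw @: up = finset.set0.
  apply/setP => x; rewrite !inE; apply/negP => /andP[lt_x /imsetP[y]].
  by rewrite inE => lt_y xy; move: lt_x; rewrite xy /= ltnNge ltnW.
by rewrite cards0 addn0 (leq_trans (max_card _)) // card_prod card_ord.
Qed.

(* Flipping one edge changes two entries of the symmetric sum, hence 2 / N. *)
Lemma energy_lip (R : realType) (N : nat) (s : config N) (e : edge N) :
  edge_lip (2 / N%:R : R) (fun G => energy R G s) e.
Proof.
move=> G; rewrite /energy -opprD normrN -mulrBr normrM [leLHS]mulrC.
rewrite (@ger0_norm _ N%:R^-1) ?invr_ge0 // ler_wpM2r ?invr_ge0 //.
pose d (x y : 'I_N * 'I_N) : R := (x == y)%:R.
have dsum x : \sum_(i < N) \sum_(j < N) d (i, j) x = 1.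
  rewrite pair_bigA /= (bigD1 x) //= /d -surjective_pairing eqxx big1 ?addr0 //.
  by move=> y yx; rewrite -surjective_pairing (negbTE yx).
(* The constant 2 is spread over the two matrix entries of [e], so that the bound can be checked
   entry by entry; spins have absolute value 1. *)
have -> : 2 = \sum_(i < N) \sum_(j < N)
    (d (i, j) (val e) + d (i, j) ((val e).2, (val e).1)).
  under eq_bigr do rewrite big_split /=.
  by rewrite big_split /= !dsum.
rewrite -sumrB (le_trans (ler_norm_sum _ _ _)) //; apply: ler_sum => i _.
rewrite -sumrB (le_trans (ler_norm_sum _ _ _)) //; apply: ler_sum => j _.
rewrite -!mulrBl !normrM /spin !normrX !normrN1 !expr1n !mulr1 /d.
have d0 (b b' : bool) : 0 <= b%:R + b'%:R :> R by rewrite addr_ge0.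
have [] := eqVneq (i, j) (val e) => [_|ne1].
  by case: (adj _ _ _); case: (adj _ _ _);
    rewrite ?subrr ?subr0 ?sub0r ?normrN ?normr0 ?normr1 ?d0 ?lerDl ?d0.
have [] := eqVneq (i, j) ((val e).2, (val e).1) => [_|ne2].
  by case: (adj _ _ _); case: (adj _ _ _);
    rewrite ?subrr ?subr0 ?sub0r ?normrN ?normr0 ?normr1 ?d0 ?lerDr ?d0.
suff -> : adj (e |: G) i j = adj (G :\ e) i j by rewrite subrr normr0 addr0.
have e_off : (val e == (i, j)) || (val e == (j, i)) = false.
  apply/negbTE; rewrite negb_or eq_sym ne1; apply: contra ne2 => /eqP ->.
  exact: eqxx.
apply: eq_existsb => e'; rewrite !inE; have [->|//] := eqVneq e' e.
by rewrite e_off.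
Qed.

(** A minimizer for either graph is a competitor for the other, so the minima differ by no more than
    the energies of one configuration do. *)
Lemma opt_value_lip (R : realType) (S : spin_space) (N : nat) (e : edge N) :
  configs N S != finset.set0 -> edge_lip (2 / N%:R : R) (@opt_value R S N) e.
Proof.
move=> S0 G.
have [[s sS optG] minG] := opt_valueP R (e |: G) S0.
have [[s' sS' optG'] minG'] := opt_valueP R (G :\ e) S0.
have := minG s' sS'; have := minG' s sS; rewrite optG optG'.
have := energy_lip R s e G; have := energy_lip R s' e G; rewrite !ler_norml; lra.
Qed.

Theorem theorem8 (R : realType) (p : R) (p_gt0 : 0 < p) (p_le1 : p <= 1)
    (S : nat -> spin_space)
    (meanO : (fun N : nat => er_mean p (@opt_value R (S N) N) : R^o)
             =O_\oo (fun N : nat => N%:R : R^o))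
    (N : nat) (N_gt0 : (0 < N)%N) (S_neq0 : configs N (S N) != finset.set0)
    (t : R) (t_gt0 : 0 < t) :
  er_prob p [pred G : graph N |
    `|opt_value R (S N) G - er_mean p (@opt_value R (S N) N)| > N%:R * t]
  <= 2 * expR (- (N%:R ^+ 2 * t ^+ 2)).
Proof.
have p01 : 0 <= p <= 1 by rewrite ltW.
have lip e := opt_value_lip R e S_neq0.
have N0 : N%:R != 0 :> R by rewrite pnatr_eq0 -lt0n.
(* With [N ^ 2 / 2] for the number of edges and [c = 2 / N], the exponent is
   [l ^ 2 / 4 - l * N * t], which is least at [l = 2 * N * t]. *)
have l0 : 0 <= 2 * N%:R * t by rewrite !mulr_ge0 // ltW.
apply: le_trans (er_prob_abs_gt (N%:R * t) p01 lip l0) _.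
rewrite ler_pM2l // ler_expR.
have -> : 2 * N%:R * t * (2 / N%:R) = 4 * t by field.
have := card_edge N; rewrite -(ler_nat R) -muln2 natrM natrX => m_le.
have := ler_wpM2r (sqr_ge0 t) m_le; lra.
Qed.
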